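(* For each $k\in\mathbb N$, $\mathcal{IS}_{br}/O(n^k)\subsetneq\mathcal{IS}_{br}/O(n^{k+1})$.
   Context: Let $\mathbb B=\{\mathsf T,\mathsf F\}$. There are Boolean registers named $\mathtt{in}{:}i$ ($i\ge1$), $\mathtt{aux}{:}i$ ($i\ge1$) and $\mathtt{out}$, processing methods $\mathtt{set{:}T}$ (content becomes $\mathsf T$, reply $\mathsf T$), $\mathtt{set{:}F}$ (content becomes $\mathsf F$, reply $\mathsf F$), $\mathtt{get}$ (no change, reply is the content). Basic instructions are $f.m$ ($f$ register name, $m$ method). Primitive instructions: for each basic instruction $a$, the plain instruction $a$, positive test $+a$, negative test $-a$; forward jumps $\#l$ ($l\in\mathbb N$); termination $!$. An instruction sequence is a finite non-empty sequence $X=u_1;\dots;u_k$ of primitive instructions, $|X|=k$. Execution starts at $u_1$: $a$ executes $a$ and proceeds with the next instruction; $+a$ executes $a$ and proceeds with the next instruction if the reply is $\mathsf T$, otherwise skips the next instruction and proceeds with the one after; $-a$ likewise with reply roles reversed; $\#l$ proceeds with the $l$-th next instruction ($\#0$ causes inaction); $!$ terminates; if there is no instruction to proceed with, inaction occurs. $\mathcal{IS}_{br}$ is the set of instruction sequences whose basic instructions are all of the forms $\mathtt{in}{:}i.\mathtt{get}$, $\mathtt{aux}{:}i.\mathtt{get}$, $\mathtt{aux}{:}i.\mathtt{set{:}}b$, $\mathtt{out}.\mathtt{set{:}}b$ ($b\in\mathbb B$). $X$ computes $f:\mathbb B^n\to\mathbb B$ if for all $b_1,\dots,b_n$, executing $X$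 with $\mathtt{in}{:}i$ initially $b_i$ ($i\le n$) and all auxiliary registers and $\mathtt{out}$ initially $\mathsf F$, execution never executes an instruction on $\mathtt{in}{:}i$ with $i>n$, ends by executing $!$, and leaves $f(b_1,\dots,b_n)$ in $\mathtt{out}$. A Boolean function family is a sequence $(f_n)_{n\in\mathbb N}$ with $f_n:\mathbb B^n\to\mathbb B$. For $\mathcal{IS}\subseteq\mathcal{IS}_{br}$ and a set $\mathcal F$ of functions $\mathbb N\to\mathbb N$, $\mathcal{IS}/\mathcal F$ is the class of Boolean function families $(f_n)$ for which there is $h\in\mathcal F$ such that for every $n$ some $X\in\mathcal{IS}$ computes $f_n$ with $|X|\le h(n)$. $\mathcal{IS}/O(g(n))$ denotes $\mathcal{IS}/\{h:\mathbb N\to\mathbb N\mid h(n)=O(g(n))\}$. *)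

(* Defs.v *)
From HB Require Import structures.
From mathcomp Require Import all_boot.
From mathcomp Require Import classical_sets.

Set Implicit Arguments.
Unset Strict Implicit.
Unset Printing Implicit Defensive.

Local Open Scope classical_set_scope.

(* Registers are numbered from 0: [In i] is the register in:(i+1) and [Aux i]
   the register aux:(i+1). *)
Inductive register := In of nat | Aux of nat | Out.

Definition register_code (r : register) : nat + option nat :=
  match r with In i => inl i | Aux i => inr (Some i) | Out => inr None end.

Definition register_decode (c : nat + option nat) : register :=
  match c with inl i => In i | inr (Some i) => Aux i | inr None => Out end.

Lemma register_codeK : cancel register_code register_decode.
Proof. by case. Qed.

HB.instance Definition _ := Equality.copy register (can_type register_codeK).

Inductive method := Set_ of bool | Get.

Definition basic := (register * method)%type.

Inductive instr :=
  | Plain of basic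
  | PosTest of basic
  | NegTest of basic
  | Jump of nat
  | Halt.

Record iseq := Iseq {
  instrs :> seq instr;
  instrs_nonempty : 0 < size instrs
}.

Definition memory := register -> bool.

(* new content and reply, in this order *)
Definition process (m : method) (content : bool) : bool * bool :=
  match m with Set_ b => (b, b) | Get => (content, content) end.

Definition reply (a : basic) (s : memory) : bool := (process a.2 (s a.1)).2.

Definition effect (a : basic) (s : memory) : memory :=
  [eta s with a.1 |-> (process a.2 (s a.1)).1].

(* The configuration (p, s) is that in which the instruction at position p
   (numbered from 0) is about to be executed in memory s. *)
Definition config := (nat * memory)%type.

(* [None] means that execution does not go on, because of either termination
   or inaction. *)
Definition step (X : iseq) (c : config) : option config :=
  let: (p, s) := c in
  match onth X p with
  | Some (Plain a) => Some (p.+1, effect a s)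
  | Some (PosTest a) => Some (if reply a s then p.+1 else p.+2, effect a s)
  | Some (NegTest a) => Some (if reply a s then p.+2 else p.+1, effect a s)
  | Some (Jump 0) => None
  | Some (Jump l) => Some (p + l, s)
  | Some Halt => None
  | None => None
  end.

(* The value at [In i] for n <= i is immaterial: [computes] forbids access to
   these registers. *)
Definition initial_memory (n : nat) (b : n.-tuple bool) : memory :=
  fun r => if r is In i then nth false b i else false.

Definition config_after (X : iseq) (s : memory) (t : nat) : option config :=
  iter t (obind (step X)) (Some (0, s)).

Definition basic_of (u : instr) : option basic :=
  match u with
  | Plain a | PosTest a | NegTest a => Some a
  | Jump _ | Halt => None
  end.

Definition computes (X : iseq) (n : nat) (f : n.-tuple bool -> bool) : Prop :=
  forall b : n.-tuple bool,
    (forall t p s i m,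
        config_after X (initial_memory b) t = Some (p, s) ->
        obind basic_of (onth X p) = Some (In i, m) -> i < n) /\
    (exists t p s,
        [/\ config_after X (initial_memory b) t = Some (p, s),
            onth X p = Some Halt
          & s Out = f b]).

Definition br_basic (a : basic) : bool :=
  match a with
  | (In _, Get) | (Aux _, _) | (Out, Set_ _) => true
  | (In _, Set_ _) | (Out, Get) => false
  end.

Definition IS_br : set iseq :=
  [set X : iseq | all (fun u => oapp br_basic true (basic_of u)) X].

Definition bool_family := forall n : nat, n.-tuple bool -> bool.

Definition complexity_class (IS : set iseq) (F : set (nat -> nat)) :
    set bool_family :=
  [set f : bool_family | exists2 h : nat -> nat, F h &
     forall n : nat, exists X : iseq,
       [/\ IS X, computes X (f n) & size X <= h n]].

Definition bigO (g : nat -> nat) : set (nat -> nat) :=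
  [set h : nat -> nat | exists c n0 : nat, forall n, n0 <= n -> h n <= c * g n].

(* Main.v *)
(* Let L = log2 n and m = (k + 1) L, so that 2 ^ m is of order n ^ (k + 1) up
   to a constant factor. Every function of the first m input bits is computed by
   a decision tree of length O(2 ^ m) = O(n ^ (k + 1)), and there are 2 ^ 2 ^ m
   such functions. On the other hand, since only the pattern of coincidences
   between the auxiliary registers matters, and jumps beyond the end can be
   identified, the instruction sequences of length at most s = n ^ k * L compute
   at most (O(n + s)) ^ s = 2 ^ O(n ^ k * L ^ 2) functions, which for large n is
   less than 2 ^ 2 ^ m. So some function of the first m bits needs length more
   than n ^ k * L, which is not O(n ^ k). *)
Require Import Defs.
From mathcomp Require Import all_boot.
From mathcomp Require Import classical_sets.
From mathcomp Require Import boolp zify.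

Local Open Scope nat_scope.
Local Open Scope classical_set_scope.

Set Implicit Arguments.
Unset Strict Implicit.
Unset Printing Implicit Defensive.

(** * Upper bound by decision trees *)

Fixpoint decision_tree (F : seq bool -> bool) (j i : nat) : seq instr :=
  if j is j'.+1 then
    let T0 := decision_tree (fun w => F (false :: w)) j' i.+1 in
    let T1 := decision_tree (fun w => F (true :: w)) j' i.+1 in
    [:: PosTest (In i, Get), Jump (size T0).+1 & T0 ++ T1]
  else [:: Plain (Out, Set_ (F [::])); Halt].

(** Each level doubles the size and adds 2, so the size plus 2 doubles, starting from 4. *)
Lemma size_decision_tree F j i : size (decision_tree F j i) + 2 = 4 * 2 ^ j.
Proof.
elim: j F i => [//|j IHj] F i /=.
have := IHj (fun w => F (false :: w)) i.+1.
have := IHj (fun w => F (true :: w)) i.+1.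
rewrite size_cat expnS; lia.
Qed.

Lemma decision_tree_basic F j i n : i + j <= n ->
  all (fun u => if basic_of u is Some a then
                  (if a.1 is In v then v < n else true) && br_basic a
                else true) (decision_tree F j i).
Proof.
elim: j F i => [//|j IHj] F i ltijn /=.
rewrite all_cat !IHj ?addSnnS // andbT; lia.
Qed.

Lemma effect_get r (s : memory) : effect (r, Get) s =1 s.
Proof. by move=> r'; rewrite /effect /=; case: eqP => [->|]. Qed.

Lemma onth_cat_size (T : Type) (s1 s2 : seq T) l :
  onth (s1 ++ s2) (size s1 + l) = onth s2 l.
Proof. by elim: s1. Qed.

(** The context [pre], [post] lets the induction hypothesis apply to subtrees in place within [X].
    The memory is arbitrary because [Get] preserves it only pointwise. *)
Lemma decision_tree_run (X : iseq) F j i pre post s :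
  instrs X = pre ++ decision_tree F j i ++ post ->
  exists t p s', [/\ iter t (obind (step X)) (Some (size pre, s)) = Some (p, s'),
    onth X p = Some Halt & s' Out = F [seq s (In v) | v <- iota i j]].
Proof.
elim: j F i pre post s => [|j IHj] F i pre post s /= defX.
  exists 1, (size pre).+1, (effect (Out, Set_ (F [::])) s).
  have X0 : onth X (size pre) = Some (Plain (Out, Set_ (F [::]))).
    by rewrite -[size pre]addn0 defX onth_cat_size.
  split=> [||//]; first by rewrite /= X0.
  by rewrite -addn1 defX onth_cat_size.
set s1 := effect (In i, Get) s.
have eq_in w : map (fun v => s (In v)) w = map (fun v => s1 (In v)) w.
  by apply: eq_map => v; rewrite /s1 effect_get.
have X0 : onth X (size pre) = Some (PosTest (In i, Get)).
  by rewrite -[size pre]addn0 defX onth_cat_size.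
set T0 := decision_tree _ j i.+1 in defX.
set T1 := decision_tree _ j i.+1 in defX.
have X1 : onth X (size pre).+1 = Some (Jump (size T0).+1).
  by rewrite -addn1 defX onth_cat_size.
(* A true reply leads to the jump over [T0]; a false one skips that jump and enters [T0]. *)
case si : (s (In i)).
- have {}defX : instrs X = (pre ++ [:: PosTest (In i, Get), Jump (size T0).+1 & T0])
                             ++ T1 ++ post.
    by rewrite defX /= -!catA.
  have [t [p [s' [run halt out]]]] := IHj _ _ _ _ s1 defX.
  exists (t + 2), p, s'; split; rewrite //; last by rewrite eq_in.
  rewrite iterD -run; congr (iter t _ _).
  rewrite /= X0 /= /reply /= si X1 size_cat /= -/s1.
  by congr (Some (_, _)); lia.
have {}defX : instrs X = (pre ++ [:: PosTest (In i, Get); Jump (size T0).+1])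
                             ++ T0 ++ (T1 ++ post).
  by rewrite defX /= -!catA.
have [t [p [s' [run halt out]]]] := IHj _ _ _ _ s1 defX.
exists (t + 1), p, s'; split; rewrite //; last by rewrite eq_in.
rewrite iterD -run; congr (iter t _ _).
rewrite /= X0 /= /reply /= si size_cat /= -/s1.
by congr (Some (_, _)); lia.
Qed.

Definition prefix_function m n (G : {ffun m.-tuple bool -> bool})
    (b : n.-tuple bool) : bool :=
  G [tuple nth false b i | i < m].

Lemma onth_mem_all (P : pred instr) (s : seq instr) p u :
  all P s -> onth s p = Some u -> P u.
Proof.
elim: s p => [|v s IHs] [|p] //= /andP[Pv Ps]; first by case=> <-.
exact: IHs.
Qed.

Lemma prefix_function_computable m n (G : {ffun m.-tuple bool -> bool}) :
  m <= n ->
  exists X : iseq, [/\ IS_br X, computes X (@prefix_function m n G)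
                     & size X <= 4 * 2 ^ m].
Proof.
move=> lemn; pose F w := G [tuple nth false w i | i < m].
pose T := decision_tree F m 0.
have szT : size T + 2 = 4 * 2 ^ m by apply: size_decision_tree.
have T_gt0 : 0 < size T by have : 0 < 2 ^ m by [rewrite expn_gt0]; lia.
have Tok : m <= n by [].
have := @decision_tree_basic F m 0 n Tok; rewrite -/T => {}Tok.
exists (Iseq T_gt0); split; last by rewrite /=; lia.
  by apply: sub_all Tok => u; case: (basic_of u) => //= a /andP[].
move=> b; split.
  move=> t p s i me _ /=; case E: (onth T p) => [u|] //= Eu.
  by have := onth_mem_all Tok E; rewrite Eu /= => /andP[].
have [|t [p [s [run halt out]]]] :=
  @decision_tree_run (Iseq T_gt0) F m 0 [::] [::] (initial_memory b).
  by rewrite /= cats0.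
exists t, p, s; split=> //; rewrite out /F /prefix_function; congr (G _).
apply: eq_mktuple => i; rewrite (nth_map 0) ?size_iota //.
by rewrite nth_iota.
Qed.

(** Padding with [false] makes every [m]-tuple the prefix of an [n]-tuple. *)
Lemma prefix_function_inj m n (G H : {ffun m.-tuple bool -> bool}) :
  m <= n -> @prefix_function m n G =1 prefix_function H -> G = H.
Proof.
move=> lemn eqGH; apply/ffunP => c.
have sz : size (c ++ nseq (n - m) false) == n.
  by rewrite size_cat size_nseq size_tuple subnKC.
have := eqGH (Tuple sz); rewrite /prefix_function.
suff -> : [tuple nth false (Tuple sz) i | i < m] = c by [].
apply: eq_from_tnth => i; rewrite tnth_mktuple /= nth_cat size_tuple ltn_ord.
by rewrite -tnth_nth.
Qed.

(** * Coding instruction sequences up to renaming of registers *)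

Definition registers (X : seq instr) : seq register :=
  pmap (fun u => omap fst (basic_of u)) X.

(* Accesses to [In i] with [n <= i] need no separate treatment: such registers
   start as [false], like the auxiliary ones. *)
Definition regcode (n : nat) (X : seq instr) (r : register) : nat :=
  match r with
  | In i => if i < n then i else n.+1 + index r (registers X)
  | Out => n
  | Aux _ => n.+1 + index r (registers X)
  end.

(** All registers but the first [n] inputs have codes at least [n], where [nth] returns its default
    [false]. Hence equal codes mean equal initial contents, even across different instruction
    sequences. *)
Lemma initial_memoryE n (b : n.-tuple bool) X r :
  initial_memory b r = nth false b (regcode n X r).
Proof.
case: r => [i|i|] /=; last 2 first.
- by rewrite nth_default // size_tuple; lia.
- by rewrite nth_default // size_tuple; lia.
case: ltnP => // leni; rewrite !nth_default // size_tuple //; lia.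
Qed.

(** Auxiliary registers absent from [X] all have the same index, whence the restriction. [Out] is
    included because its final content is compared even if [X] never mentions it. *)
Lemma regcode_inj n X : {in Out :: registers X &, injective (regcode n X)}.
Proof.
have idx r r' : r \in registers X ->
  index r (registers X) = index r' (registers X) -> r = r'.
  move=> rX E; have r'X : r' \in registers X by rewrite -index_mem -E index_mem.
  by rewrite -(nth_index Out rX) E nth_index.
move=> r r'; rewrite !inE.
case: r => [i|i|]; case: r' => [i'|i'|] //=; do ?case: ltnP => ?;
  move=> rX r'X E; try (by exfalso; lia); try (by congr In);
  by apply: idx => //; lia.
Qed.

Lemma regcode_lt n s X r : size X <= s -> r \in Out :: registers X ->
  regcode n X r < (n + s).+1.
Proof.
move=> szX; have szr : size (registers X) <= s.
  by rewrite size_pmap (leq_trans (count_size _ _)) ?size_map.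
rewrite inE => /predU1P[->|] /=; first lia.
rewrite -index_mem /regcode; move: (index r _) => d /leq_trans/(_ szr) ltds.
by case: r => [i|i|]; first case: (ltnP i n) => ?; lia.
Qed.

Definition method_code (m : method) : option bool :=
  if m is Set_ b then Some b else None.

Lemma method_code_inj : injective method_code.
Proof. by case=> [b|] [b'|] //= [->]. Qed.

Definition basic_code n s X (k : option bool) (a : basic) :
    option bool * option bool * 'I_(n + s).+1 :=
  (k, method_code a.2, inord (regcode n X a.1)).

Definition instr_code n s X (u : instr) :
    option (option bool * option bool * 'I_(n + s).+1 + 'I_s.+1) :=
  match u with
  | Plain a => Some (inl (basic_code n s X None a))
  | PosTest a => Some (inl (basic_code n s X (Some true) a))
  | NegTest a => Some (inl (basic_code n s X (Some false) a))
  | Jump l => Some (inr (inord l))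
  | Halt => None
  end.

(* For [size X <= s], [inord] only conflates jumps by more than [s] with [Jump 0],
   which do not lead to a position in X either. *)
Definition iseq_code n s (X : seq instr) :=
  [ffun p : 'I_s => omap (instr_code n s X) (onth X p)].

(** * Equal codes give parallel runs *)

Section Simulation.

Variables (n s : nat) (X Y : iseq).
Hypotheses (szX : size X <= s) (szY : size Y <= s).
Hypothesis eqXY : iseq_code n s X = iseq_code n s Y.

(** The simulation relation: [X] and [Y] may name their registers differently, so contents are
    matched through codes. *)
Definition same_memory (mX mY : memory) : Prop :=
  forall r r', r \in Out :: registers X -> r' \in Out :: registers Y ->
  regcode n X r = regcode n Y r' -> mX r = mY r'.

Lemma onth_code p u : onth X p = Some u ->
  exists2 v, onth Y p = Some v & instr_code n s X u = instr_code n s Y v.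
Proof.
move=> Xp; have ltps : p < s.
  by apply: leq_trans szX; rewrite ltnNge; apply/negP => /onth_default; rewrite Xp.
have /ffunP/(_ (Ordinal ltps)) := eqXY; rewrite !ffunE /= Xp /=.
by case: (onth Y p) => //= v [E]; exists v.
Qed.

Lemma onth_registers (Z : seq instr) p u a : onth Z p = Some u ->
  basic_of u = Some a -> a.1 \in Out :: registers Z.
Proof.
move=> Zp ua; rewrite inE; apply/orP; right.
elim: Z p Zp => [|v Z IHZ] [|p] //= => [[->]|/IHZ aZ].
  by rewrite /registers /= ua mem_head.
by rewrite /registers /=; case: omap => //= r; rewrite inE aZ orbT.
Qed.

Lemma same_effect k a a' mX mY :
    a.1 \in Out :: registers X -> a'.1 \in Out :: registers Y ->
    basic_code n s X k a = basic_code n s Y k a' -> same_memory mX mY ->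
  reply a mX = reply a' mY /\ same_memory (effect a mX) (effect a' mY).
Proof.
move=> aX aY [/method_code_inj Em /(congr1 val)/=].
rewrite !inordK ?regcode_lt // => Er same.
have E := same _ _ aX aY Er.
split=> //; first by rewrite /reply Em E.
move=> r r' rX rY Err; rewrite /effect /= Em E.
(* Injectivity of both codings makes [r] the written register exactly when [r'] is. *)
have -> : (r == a.1) = (r' == a'.1).
  apply/eqP/eqP => Ea.
    by apply: (regcode_inj (n := n) rY aY); rewrite -Err Ea.
  by apply: (regcode_inj (n := n) rX aX); rewrite Err Ea.
by case: eqP => // _; apply: same.
Qed.

Lemma same_step p p1 mX mX1 mY : same_memory mX mY ->
    step X (p, mX) = Some (p1, mX1) -> p1 < size X ->
  exists2 mY1, step Y (p, mY) = Some (p1, mY1) & same_memory mX1 mY1.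
Proof.
move=> same; rewrite /step; case Xp: (onth X p) => [u|] //.
have [v Yp] := onth_code Xp.
have uX := onth_registers Xp; have vY := onth_registers Yp; rewrite Yp.
case: u v {Xp Yp} uX vY => [a|a|a|l|] [a'|a'|a'|l'|] uX vY //= Euv.
1-3: have {}Euv := inl_inj (Some_inj Euv).
1-3: have [Ereply same1] := same_effect (uX _ erefl) (vY _ erefl) Euv same.
1-3: by move=> [<- <-] _; rewrite ?Ereply; exists (effect a' mY).
case: l uX Euv => [|l] // uX [/(congr1 val)/= El] [<- <-] ltlX.
(* Since [p + l.+1 < size X <= s], [inord] keeps [l.+1]. Being nonzero, this is not the default 0
   given to an overlong [l'], so [l'] equals [l.+1]. *)
move: El; rewrite inordK; last by lia.
rewrite val_insubd; case: ltnP => //= _ <-; by exists mY.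
Qed.

Lemma same_run (b : n.-tuple bool) t p mX :
    config_after X (initial_memory b) t = Some (p, mX) -> p < size X ->
  exists2 mY, config_after Y (initial_memory b) t = Some (p, mY)
            & same_memory mX mY.
Proof.
elim: t p mX => [|t IHt] p mX /=.
  case=> <- <- _; exists (initial_memory b) => // r r' _ _ E.
  by rewrite (initial_memoryE b X) E -initial_memoryE.
rewrite /config_after /= -/(config_after X _ t) -/(config_after Y _ t).
case Ht: (config_after X _ t) => [[p0 mX0]|] //= st ltpX.
(* No step is possible from outside [X], so [p0] lies in [X]. *)
have [|mY0 -> same0] := IHt _ _ Ht.
  rewrite ltnNge; apply/negP => /onth_default E.
  by move: st; rewrite /= E.
exact: same_step st ltpX.
Qed.

End Simulation.

(** After a halting configuration the iteration yields [None] forever, so neither halting time can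
    precede the other. *)
Lemma halting_time_unique (X : iseq) m t p s t' p' s' :
  config_after X m t = Some (p, s) -> onth X p = Some Halt ->
  config_after X m t' = Some (p', s') -> onth X p' = Some Halt -> t = t'.
Proof.
have stop t1 t2 p1 s1 c : config_after X m t1 = Some (p1, s1) ->
  onth X p1 = Some Halt -> config_after X m t2 = Some c -> t2 <= t1.
  move=> H1 halt H2; rewrite leqNgt; apply/negP => lt12; move: H2.
  rewrite -(subnK lt12) /config_after iterD /= -/(config_after X m t1) H1 /= halt.
  by rewrite (_ : iter _ _ None = None) //; elim: (t2 - _) => //= ? ->.
move=> run halt run' halt'; apply/eqP; rewrite eqn_leq.
by rewrite (stop _ _ _ _ _ run' halt' run) (stop _ _ _ _ _ run halt run').
Qed.

Lemma iseq_code_computes n s (X Y : iseq) (f g : n.-tuple bool -> bool) :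
  size X <= s -> size Y <= s -> iseq_code n s X = iseq_code n s Y ->
  computes X f -> computes Y g -> f =1 g.
Proof.
move=> szX szY eqXY Xf Yg b.
have [_ [t [p [m [run halt <-]]]]] := Xf b.
have [_ [t' [p' [m' [run' halt' <-]]]]] := Yg b.
have ltpX : p < size X by rewrite ltnNge; apply/negP => /onth_default; rewrite halt.
have [mY runY same] := same_run szX szY eqXY run ltpX.
have [v haltY] := onth_code szX eqXY halt.
(* Only [Halt] has code [None], so [Y] halts at the same position and time, and [Out] has code [n]
   on both sides. *)
case: v haltY => // haltY _.
have Et := halting_time_unique runY haltY run' halt'.
move: run'; rewrite -Et runY => -[_ <-].
by apply: same; rewrite ?mem_head.
Qed.

(** * Counting and the choice of parameters *)

Lemma hard_prefix_function m n s :
  m <= n -> (9 * (n + s).+1 + s + 3) ^ s < 2 ^ 2 ^ m ->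
  exists G : {ffun m.-tuple bool -> bool}, forall X : iseq,
    computes X (@prefix_function m n G) -> s < size X.
Proof.
move=> lemn lt_codes; apply: contrapT => no_hard.
have small (G : {ffun m.-tuple bool -> bool}) :
    exists X : iseq, computes X (@prefix_function m n G) /\ size X <= s.
  apply: contrapT => Gbig; apply: no_hard; exists G => X XG.
  by rewrite ltnNge; apply/negP => szX; apply: Gbig; exists X.
have [P PP] := choice small.
have codeI : injective (fun G => iseq_code n s (P G)).
  move=> G H eqGH; have [PG szG] := PP G; have [PH szH] := PP H.
  exact/(prefix_function_inj lemn)/(iseq_code_computes szG szH eqGH).
(* Each of the [s] positions has [9 * (n + s).+1] codes with a basic instruction (3 forms, 3
   methods, a register), [s.+1] for jumps, one for [Halt] and one for being past the end. *)
have := leq_card _ codeI.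
rewrite !card_ffun !card_ord !card_option card_sum !card_prod !card_option.
rewrite !card_ord card_tuple card_bool leqNgt => /negP; apply.
by congr (_ ^ _ < _): lt_codes; lia.
Qed.

Lemma leq_exp2 m n e : m <= n -> m ^ e <= n ^ e.
Proof. by case: e => // e lemn; rewrite leq_exp2r. Qed.

(** At 10 this reads [1000 <= 1024]; from there on the cube at most doubles at each step. *)
Lemma cube_le_exp2 L : 10 <= L -> L ^ 3 <= 2 ^ L.
Proof.
move=> /subnK <-; elim: (L - 10) => [//|d IHd].
rewrite addSn [2 ^ _]expnS.
apply: leq_trans (_ : 2 * (d + 10) ^ 3 <= _); last by rewrite leq_mul2l.
rewrite !expnSr !expn0; nia.
Qed.

Lemma code_count_lt k n L : 2 ^ L <= n -> n < 2 ^ L.+1 ->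
  2 ^ k * (2 * k + 20) <= L ->
  (9 * (n + n ^ k * L).+1 + n ^ k * L + 3) ^ (n ^ k * L) < 2 ^ 2 ^ (k.+1 * L).
Proof.
move=> leLn ltnL leL; set A := n ^ k * L; set E := k.+1 * L.+1 + 5.
have k2_gt0 : 0 < 2 ^ k by rewrite expn_gt0.
have L_ge20 : 20 <= L by nia.
have nk : n ^ k <= 2 ^ (k * L.+1).
  by rewrite mulnC expnM leq_exp2 // ltnW.
have leA : A <= 2 ^ (k.+1 * L.+1).
  rewrite mulSn addnC expnD leq_mul // expnS; have := ltn_expl L (isT : 1 < 2); lia.
have lenE : n < 2 ^ (k.+1 * L.+1).
  by apply: leq_trans ltnL _; rewrite leq_exp2l // mulSn leq_addr.
(* With [M = 2 ^ (k.+1 * L.+1)], [n < M] and [A <= M] bound the base by [22 * M], which the 5 in [E]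
   absorbs. *)
have le_base : 9 * (n + A).+1 + A + 3 <= 2 ^ E.
  by rewrite /E expnD; move: (2 ^ _) A lenE leA => M B; lia.
apply: (@leq_ltn_trans (2 ^ (E * A))).
  by rewrite expnM; apply: leq_exp2.
rewrite ltn_exp2l //; apply: (@leq_ltn_trans (2 ^ (k * L) * (2 ^ k * L * E))).
  rewrite mulnC !mulnA leq_mul // leq_mul // -expnD.
  by apply: leq_trans nk _; rewrite leq_exp2l //; lia.
(* Cancelling [2 ^ (k * L)] leaves [2 ^ k * L * E < 2 ^ L]. As [E <= L * (2 * k + 7)] and
   [2 ^ k * (2 * k + 7) < L], the left side is below [L ^ 3]. *)
rewrite mulSn [L + _]addnC expnD ltn_pmul2l ?expn_gt0 //.
apply: leq_trans (cube_le_exp2 _); last by lia.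
have leE : E <= L * (2 * k + 7) by rewrite /E; nia.
apply: (@leq_ltn_trans (2 ^ k * L * (L * (2 * k + 7)))); first by rewrite leq_mul.
rewrite (_ : L ^ 3 = L * L * L); last by rewrite !expnS expn0; lia.
rewrite (_ : _ * _ = L * L * (2 ^ k * (2 * k + 7))); last by lia.
rewrite ltn_pmul2l; nia.
Qed.

Lemma hard_function k n : exists f : n.-tuple bool -> bool,
  (exists X : iseq, [/\ IS_br X, computes X f & size X <= 4 * n ^ k.+1 + 4]) /\
  (2 ^ k * (2 * k + 20) <= trunc_log 2 n ->
   forall X : iseq, computes X f -> n ^ k * trunc_log 2 n < size X).
Proof.
set L := trunc_log 2 n.
case: (leqP (2 ^ k * (2 * k + 20)) L) => [leL|_]; last first.
  (* For small [L] the lower bound is vacuous, and a constant function of size at most 4 serves;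
     this explains the summand 4. *)
  have [X [brX compX szX]] :=
    prefix_function_computable [ffun _ : 0.-tuple bool => false] (leq0n n).
  exists (prefix_function [ffun _ : 0.-tuple bool => false]); split=> //.
  by exists X; split=> //; apply: leq_trans szX _; lia.
have k2_gt0 : 0 < 2 ^ k by rewrite expn_gt0.
have n_gt0 : 0 < n.
  rewrite lt0n; apply: contraTneq leL; rewrite /L => ->.
  by rewrite trunc_log0; nia.
have /andP[leLn ltnL] := trunc_log_bounds (isT : 1 < 2) n_gt0.
(* The chain is [k.+1 * L <= L ^ 3 <= 2 ^ L <= n]. *)
have lemn : k.+1 * L <= n.
  apply: leq_trans leLn; apply: leq_trans (cube_le_exp2 _); last by nia.
  rewrite (_ : L ^ 3 = L * L * L); last by rewrite !expnS expn0; lia.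
  by rewrite leq_mul //; nia.
have [G hardG] := hard_prefix_function lemn (code_count_lt leLn ltnL leL).
have [X [brX compX szX]] := prefix_function_computable G lemn.
exists (prefix_function G); split=> //; exists X; split=> //.
apply: leq_trans szX _; apply: leq_trans (leq_addr _ _); rewrite leq_mul //.
by rewrite mulnC expnM leq_exp2.
Qed.

Theorem theorem4 :
  forall k : nat,
    complexity_class IS_br (bigO (fun n => n ^ k)) `<`
    complexity_class IS_br (bigO (fun n => n ^ k.+1)).
Proof.
move=> k; split.
  (* The case [n = 0] is avoided because [0 ^ 0 > 0 ^ 1]. *)
  move=> f [h [c [n0 hO]] fh]; exists h => //; exists c, (maxn 1 n0) => n.
  rewrite geq_max => /andP[n_gt0 /hO /leq_trans]; apply.
  by rewrite leq_mul // leq_pexp2l.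
pose f n := projT1 (cid (hard_function k n)).
have fP n := projT2 (cid (hard_function k n)).
move=> /(_ f)[].
  exists (fun n => 4 * n ^ k.+1 + 4) => [|n]; last by have [] := fP n.
  exists 8, 1 => n n_gt0; have : 0 < n ^ k.+1 by rewrite expn_gt0 n_gt0.
  lia.
move=> h [c [n0 hO]] fh.
(* The three bounds on [L] make the lower bound apply, give [c * n ^ k <= n ^ k * L], and ensure
   [n0 <= n]; a power of 2 has logarithm exactly [L]. *)
pose L := maxn (2 ^ k * (2 * k + 20)) (maxn c n0); pose n := 2 ^ L.
have logn : trunc_log 2 n = L by rewrite trunc_expnK.
have [X [_ fX szX]] := fh n.
have [_] := fP n; rewrite -/(f n) => hard.
have {}hard : n ^ k * L < size X by rewrite -logn hard // logn leq_maxl.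
move: hard; rewrite ltnNge => /negP; apply; apply: leq_trans szX _.
have leL : n0 <= n by have := ltn_expl L (isT : 1 < 2); rewrite -/n /L; lia.
apply: leq_trans (hO n leL) _; rewrite mulnC leq_mul // /L; lia.
Qed.
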